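(* Let $n\ge1$, and let $\Gamma=([n],A(\Gamma))$ be a digraph with loops allowed and with $A(\Gamma)\subseteq[n]\times([n]\setminus\{1\})$. Let $$\mathrm{Ish}(\Gamma)=\{x_i-x_j=0\mid 1\le i<j\le n\}\cup\{x_1-x_j=i\mid (i,j)\in A(\Gamma)\},$$ an arrangement in $\mathbb R^n$, and let $\bar\Gamma(1)$ be the digraph on $[n]$ with arc set $$A(\bar\Gamma(1))=\{(i,j)\mid 1\le i\le n,\ 1\le j\le n,\ j\ne1\}\setminus A(\Gamma).$$ Then $$\chi(\mathrm{Ish}(\Gamma),t)=t\sum_{k=1}^{n}\mathrm{pc}_k(\bar\Gamma(1))\,(t-n-1)^{\underline{k-1}}.$$
   Context: Notation: $[n]=\{1,\dots,n\}$. Falling factorial: $x^{\underline r}=x(x-1)\cdots(x-r+1)$, $x^{\underline 0}=1$. For a finite hyperplane arrangement $\mathcal A$ in $\mathbb R^n$, $L(\mathcal A)$ is the poset of nonempty intersections of subfamilies of $\mathcal A$, ordered by reverse inclusion, with minimum $\hat 0=\mathbb R^n$ (the empty intersection). With $\mu$ the Möbius function of $L(\mathcal A)$, the characteristic polynomial is $\chi(\mathcal A,t)=\sum_{X\in L(\mathcal A)}\mu(\hat 0,X)t^{\dim X}$. Arc sets are sets of ordered pairs (no repeated arcs); an arc $(i,j)$ has tail $i$ and head $j$, and loops $(i,i)$ may occur. For a digraph $\Delta=([n],A(\Delta))$ with loops allowed, a directed path-cycle cover of $\Delta$ is a spanning subgraph $F=([n],S)$, $S\subseteq A(\Delta)$,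 each of whose weakly connected components is either a directed path or a directed cycle. An isolated vertex is regarded as a directed path of length $0$, and a loop as a directed cycle of length $1$. $\mathrm{pc}_r(\Delta)$ denotes the number of directed path-cycle covers of $\Delta$ with exactly $r$ directed path components. *)

(* Defs.v *)
From HB Require Import structures.
From mathcomp Require Import all_boot all_order all_algebra finmap.
From mathcomp Require Import boolp classical_sets reals.

Set Implicit Arguments.
Unset Strict Implicit.
Unset Printing Implicit Defensive.

Import Order.TTheory GRing.Theory Num.Theory.

Local Open Scope ring_scope.

Definition falling (K : pzRingType) (x : K) (r : nat) : K :=
  \prod_(i < r) (x - i%:R).

Section Digraph.

Variable V : finType.
Implicit Types (S D : {set V * V}) (C : {set V}) (s : seq V).

Definition adjacent S : rel V := fun u v => ((u, v) \in S) || ((v, u) \in S).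

Definition weak_components S : {set {set V}} :=
  equivalence_partition (connect (adjacent S)) [set: V].

Definition arcs_within S C : {set V * V} :=
  [set a in S | (a.1 \in C) && (a.2 \in C)].

(* For s = [:: v_0; ...; v_l], the arcs (v_i, v_(i+1)) with i < l. *)
Definition path_arcs s : {set V * V} := [set a in zip s (behead s)].

(* The same with the closing arc (v_l, v_0); a loop when s = [:: v_0]. *)
Definition cycle_arcs s : {set V * V} := [set a in zip s (rot 1 s)].

Definition dipath_on S C : bool :=
  [exists s : #|C|.-tuple V,
    [&& uniq s, [set v in s] == C & arcs_within S C == path_arcs s]].

Definition dicycle_on S C : bool :=
  [exists s : #|C|.-tuple V,
    [&& uniq s, [set v in s] == C & arcs_within S C == cycle_arcs s]].

Definition path_cycle_cover D S : bool :=
  (S \subset D) &&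
  [forall C in weak_components S, dipath_on S C || dicycle_on S C].

Definition num_paths S : nat := #|[set C in weak_components S | dipath_on S C]|.

Definition pc (r : nat) D : nat :=
  #|[set S | path_cycle_cover D S & num_paths S == r]|.

End Digraph.

Section Mobius.

Variables (T : choiceType) (le : rel T) (P : {fset T}).

(* mu(x,x) = 1 and mu(x,y) = - \sum_(x <= z < y) mu(x,z), by recursion on a
   bound k on the number of elements of a chain from x to y. *)
Fixpoint mobius_rec (k : nat) (x y : T) : int :=
  if k is k'.+1 then
    if x == y then 1
    else if le x y then
      - \sum_(z <- P | [&& le x z, le z y & z != y]) mobius_rec k' x z
    else 0
  else 0.

Definition mobius (x y : T) : int := mobius_rec #|` P| x y.

Hypotheses (le_refl : reflexive le) (le_anti : antisymmetric le).
Hypothesis le_trans : transitive le.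

Lemma mobius_recE k x y : x \in P -> y \in P ->
  (#|` [fset z in P | le x z && le z y]%fset| <= k)%N ->
  mobius_rec k x y = mobius_rec k.+1 x y.
Proof.
elim: k x y => [|k IHk] x y xP yP.
  rewrite leqn0 cardfs_eq0 => /eqP e0.
  have /= [exy|_] := eqVneq x y.
    have: x \in [fset z in P | le x z && le z y]%fset.
      by rewrite !inE xP exy le_refl.
    by rewrite e0 inE.
  case: ifP => // lxy; have: x \in [fset z in P | le x z && le z y]%fset.
    by rewrite !inE xP lxy le_refl.
  by rewrite e0 inE.
move=> lek; rewrite [LHS]/= [RHS]/=; case: eqVneq => // nxy.
case: ifP => // lxy; congr (- _).
rewrite big_seq_cond [RHS]big_seq_cond; apply: eq_bigr => z.
case/and4P=> zP lxz lzy nzy; apply: IHk => //.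
rewrite -ltnS; apply: leq_trans lek; apply: fproper_ltn_card.
rewrite fproperE; apply/andP; split.
  apply/fsubsetP => w; rewrite !inE => /and3P[-> -> lwz] /=.
  exact: le_trans lwz lzy.
apply/negP => /fsubsetP/(_ y); rewrite !inE yP lxy le_refl => /(_ isT) /= lyz.
by case/negP: nzy; apply/eqP/le_anti; rewrite lzy.
Qed.

Lemma mobiusE x y : x \in P -> y \in P ->
  mobius x y =
    if x == y then 1
    else if le x y then
      - \sum_(z <- P | [&& le x z, le z y & z != y]) mobius x z
    else 0.
Proof.
move=> xP yP; rewrite /mobius mobius_recE //.
by apply: fsubset_leq_card; apply/fsubsetP => z; rewrite !inE => /andP[].
Qed.

End Mobius.

Local Open Scope classical_set_scope.

Section Arrangement.

Variables (R : realType) (n : nat).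
Implicit Types (H X Y : set 'rV[R]_n) (A : {fset set 'rV[R]_n}).

(* The subfamily B = fset0 contributes the whole space setT. *)
Definition flats A : {fset set 'rV[R]_n} :=
  [fset X in [fset \bigcap_(H in [set` B]) H
               | B : {fset set 'rV[R]_n} in fpowerset A]
     | `[< X !=set0 >]]%fset.

Definition flat_le X Y : bool := `[< Y `<=` X >].

Definition direction X : {vspace 'rV[R]_n} :=
  xget 0%VS [set U | exists x, X = [set x + u | u in [set` U]]].

Definition affine_dim X : nat := \dim (direction X).

Definition char_poly_arr A : {poly int} :=
  \sum_(X <- flats A) mobius flat_le (flats A) setT X *: 'X^(affine_dim X).

End Arrangement.

Section Ish.

Variables (n : nat) (n_gt0 : (0 < n)%N).

(* The vertex i of {1, ..., n} is represented by the ordinal i - 1 of 'I_n. *)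
Definition vertex1 : 'I_n := Ordinal n_gt0.

Definition Ish (R : realType) (G : {set 'I_n * 'I_n}) :
    {fset set 'rV[R]_n} :=
  ([fset [set x : 'rV[R]_n | x ord0 a.1 - x ord0 a.2 = 0]
     | a : 'I_n * 'I_n & (a.1 < a.2)%N] `|`
   [fset [set x : 'rV[R]_n | x ord0 vertex1 - x ord0 a.2 = a.1.+1%:R]
     | a : 'I_n * 'I_n in G])%fset.

Definition Ish_complement (G : {set 'I_n * 'I_n}) : {set 'I_n * 'I_n} :=
  ([set a | a.2 != vertex1] :\: G)%SET.

End Ish.

(* Main.v *)
Require Import Defs.
From HB Require Import structures.
From mathcomp Require Import all_boot all_order all_algebra finmap.
From mathcomp Require Import boolp classical_sets reals.

Set Implicit Arguments.
Unset Strict Implicit.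
Unset Printing Implicit Defensive.

Import Order.TTheory GRing.Theory Num.Theory.

Local Open Scope ring_scope.

(** Both sides are polynomials, so it is enough to compare them at all large
integers q, and there the left-hand side counts points, as in the finite field
method of Athanasiadis.

The equations of the arrangement have integer coefficients, hence make sense
in (Z/q)^n.  As soon as q > n, a family of them is solvable over the reals iff
it is solvable modulo q, and its solutions modulo q then number q^d, where d is
the dimension of the real flat (lemmas difference_lift and difference_card).
Moebius inversion in the poset of flats turns this into
  chi(q) = number of points of (Z/q)^n that satisfy none of the equations
(char_poly_arr_model).  Every q > n is good, prime or not, because the equations
are very special: each is either x_i = x_j or x_1 - x_j = c with 0 <= c < q, so
that the integers 0, ..., q-1 are legitimate real values of the x_1 - x_j.

Such a point y is given by y_1, for which there are q choices, and by the
values z_j = y_1 - y_j: they are pairwise distinct, z_1 = 0, and z_j <> i for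
every arc (i, j) of G.  Draw an arc (i, j) whenever z_j = i is one of 1, ..., n.
Every vertex has then at most one incoming arc, since z is a function, and
at most one outgoing arc, since z is injective, and no arc enters 1 or belongs
to G.  Arc sets with these degree bounds are exactly the path-cycle covers
(path_cycle_coverP), and a cover with k paths leaves k vertices without
incoming arc (num_paths_cover): one of them is 1, and the k-1 others take
distinct values in {n+1, ..., q-1}.  So a cover with k paths comes from
(q-n-1)(q-n-2)...(q-n-k+1) functions z (card_small_arcs_fibre), and summing
over the covers gives the right-hand side at q. *)

(** * Characteristic polynomials by counting points in a finite model *)

Section FiniteModel.

Variables (R : realType) (n : nat).
Implicit Types (X Y : set 'rV[R]_n) (A : {fset set 'rV[R]_n}).

Lemma flat_le_refl : reflexive (@flat_le R n).
Proof. by move=> X; apply/asboolP. Qed.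

Lemma flat_le_anti : antisymmetric (@flat_le R n).
Proof. by move=> X Y /andP[/asboolP YX /asboolP XY]; apply/seteqP. Qed.

Lemma flat_le_trans : transitive (@flat_le R n).
Proof.
by move=> Y X Z /asboolP YX /asboolP ZY; apply/asboolP => x /ZY; apply: YX.
Qed.

(** The defining recursion of the Moebius function, read as Moebius inversion:
the values over the interval from the whole space to Y cancel unless that
interval is a single point. *)
Lemma mobius_flats_sum A Y : setT \in flats A -> Y \in flats A ->
  \sum_(X <- flats A | flat_le X Y) mobius (@flat_le R n) (flats A) setT X =
  (Y == setT)%:R.
Proof.
move=> AT AY; rewrite (big_rem Y) //= flat_le_refl.
rewrite (mobiusE flat_le_refl flat_le_anti flat_le_trans AT AY) eq_sym.
have leT X : flat_le setT X by apply/asboolP.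
have uniqF := fset_uniq (flats A).
rewrite rem_filter // big_filter_cond.
case: eqVneq => [->|nYT]; last first.
  rewrite leT; apply/eqP; rewrite addrC subr_eq0; apply/eqP/eq_bigl => X.
  by rewrite leT andbC.
rewrite big1 ?addr0// => X /andP[/= nXT XT].
by case/negP: nXT; apply/eqP/flat_le_anti; rewrite XT leT.
Qed.

Variables (E Q : finType) (q : nat) (h : E -> set 'rV[R]_n) (m : E -> pred Q).

Definition solutions (B : {set E}) : set 'rV[R]_n :=
  [set x | forall e, e \in B -> h e x]%classic.

Definition model_solutions (B : {set E}) : {set Q} :=
  [set y | [forall e in B, m e y]]%SET.

Lemma in_model_solutions (B : {set E}) y :
  reflect (forall e, e \in B -> m e y) (y \in model_solutions B).
Proof. by rewrite inE; apply: forall_inP. Qed.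

Variable A : {fset set 'rV[R]_n}.
Hypothesis A_h : forall H, H \in A <-> exists e, H = h e.

(** Flats are easier to handle as solution sets of families of equations than
as intersections of families of sets, since several equations may define the
same hyperplane. *)
Lemma flatsP X :
  reflect ((X !=set0)%classic /\ exists B, X = solutions B) (X \in flats A).
Proof.
apply: (iffP idP).
  rewrite !inE /= => /andP[/imfsetP[B /= BA XE] /asboolP X0]; split=> //.
  exists [set e | h e \in B]%SET; rewrite XE; apply/seteqP.
  split=> x /= xX => [e|H HB]; first by rewrite inE => /xX.
  have /A_h[e He] : H \in A by move: BA; rewrite fpowersetE => /fsubsetP; apply.
  by rewrite He; apply: xX; rewrite inE -He.
case=> X0 [B XE]; rewrite !inE /=; apply/andP; split; last exact/asboolP.
apply/imfsetP; exists [fset h e | e in B]%fset => /=.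
  rewrite fpowersetE; apply/fsubsetP => H /imfsetP[e /= _ ->].
  by apply/A_h; exists e.
rewrite XE; apply/seteqP; split=> x /= xX.
  by move=> H /= /imfsetP[e /= eB ->]; apply: xX.
by move=> e eB; apply: (xX (h e)) => /=; apply/imfsetP; exists e.
Qed.

Hypothesis h_proper : forall e, h e <> setT.
Hypothesis model_lift :
  forall y, exists x, forall e, m e y -> h e x.
Hypothesis model_card : forall B, (solutions B !=set0)%classic ->
  #|model_solutions B| = (q ^ affine_dim (solutions B))%N.

(** The point counts alone force every equation that holds on a real flat to
hold on its model: adding such an equation to the family B does not change the
dimension of the flat, hence not the number of model points either. *)
Lemma model_implied B e : (solutions B !=set0)%classic ->
  (solutions B `<=` h e)%classic -> {subset model_solutions B <= m e}.
Proof.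
move=> B0 Bh y yB.
have BeE : solutions (e |: B)%SET = solutions B.
  apply/seteqP; split=> x /= xB => [f fB|f].
    by apply: xB; rewrite setU1r.
  by case/setU1P=> [->|]; [apply: Bh | apply: xB].
have sub : model_solutions (e |: B)%SET \subset model_solutions B.
  apply/fintype.subsetP => z /in_model_solutions zB.
  apply/in_model_solutions => f fB.
  by apply: zB; rewrite setU1r.
have /eqP eqB : model_solutions (e |: B)%SET == model_solutions B.
  by rewrite eqEcard sub !model_card ?BeE /=.
by move: yB; rewrite -eqB => /in_model_solutions; apply; rewrite setU11.
Qed.

(** Summing the cardinal q^(dim X) of the model of X, weighted by mu(X), over all
flats X counts each model point y with the sum of mu over the flats whose model
contains y.  These flats are the ones below the flat cut out by the equations
that y satisfies, so mobius_flats_sum makes the weight of y equal to 1 when y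
satisfies no equation and 0 otherwise. *)
Theorem char_poly_arr_model :
  (char_poly_arr A).[q%:R] = #|[set y : Q | [forall e, ~~ m e y]]%SET|%:R.
Proof.
pose below X := [set e | `[< (X `<=` h e)%classic >]]%SET.
pose at_point y := [set e | m e y]%SET.
have belowK B : solutions (below (solutions B)) = solutions B.
  apply/seteqP; split=> x xB e.
    by move=> eB; apply: xB; rewrite inE; apply/asboolP => z; apply.
  by rewrite inE => /asboolP; apply.
have at_flat y : solutions (at_point y) \in flats A.
  apply/flatsP; split; last by exists (at_point y).
  by have [x xy] := model_lift y; exists x => e; rewrite inE => /xy.
have T_flat : setT \in flats A.
  apply/flatsP; split; first by exists 0.
  by exists finset.set0; apply/seteqP; split=> // x _ e; rewrite inE.
have flat_card X : X \in flats A ->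
    #|model_solutions (below X)| = (q ^ affine_dim X)%N.
  by case/flatsP=> X0 [B XE]; rewrite model_card XE belowK // -XE.
have flat_model X y : X \in flats A ->
    (y \in model_solutions (below X)) = flat_le X (solutions (at_point y)).
  case/flatsP=> X0 [B XE]; apply/in_model_solutions/asboolP.
    move=> yX x xy; rewrite XE -belowK -XE => e /yX mey.
    by apply: xy; rewrite inE.
  move=> le e; rewrite inE => /asboolP Xe.
  have /flatsP[y0 _] := at_flat y.
  apply: (@model_implied (at_point y)) => //; first by move=> x /le /Xe.
  by apply/in_model_solutions => f; rewrite inE.
rewrite /char_poly_arr horner_sum.
transitivity (\sum_(X <- flats A)
    \sum_(y : Q | flat_le X (solutions (at_point y)))
      mobius (@flat_le R n) (flats A) setT X).
  rewrite big_seq [RHS]big_seq; apply: eq_bigr => X AX.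
  rewrite hornerZ hornerXn -natrX -flat_card // sumr_const mulr_natr.
  by congr (_ *+ _); apply: eq_card => y; rewrite flat_model.
rewrite (exchange_big_dep predT) //=.
under eq_bigr => y _ do rewrite mobius_flats_sum //.
rewrite -sum1dep_card natr_sum [RHS]big_mkcond /=; apply: eq_bigr => y _.
case: ifPn => [/forallP none|/forallPn[e /negPn ye]].
  suff -> : solutions (at_point y) = setT by rewrite eqxx.
  by apply/seteqP; split=> // x _ e; rewrite inE (negPf (none e)).
case: eqP => // solT; case: (@h_proper e); apply/seteqP; split=> // x _.
have: solutions (at_point y) x by rewrite solT.
by apply; rewrite inE.
Qed.

End FiniteModel.

(** * Systems of equations x_a - x_b = c, over the reals and modulo q *)

(** The functions compatible with r are freely parametrized by their values on
the k classes of the equivalence generated by r.  Quantifying over the codomain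
T lets the same k measure both a real dimension and a cardinal modulo q. *)
Lemma relation_quotient (I : finType) (r : rel I) :
  exists (k : nat) (cls : I -> 'I_k) (rep : 'I_k -> I),
    [/\ cancel rep cls, forall a b, r a b -> cls a = cls b
      & forall (T : Type) (u : I -> T),
          (forall a b, r a b -> u a = u b) -> u =1 u \o rep \o cls].
Proof.
pose r' a b := r a b || r b a.
have r'C : connect_sym r'.
  by apply: sym_connect_sym => a b; rewrite /r' orbC.
pose S := {a | fingraph.root r' a == a}.
have rootS a : fingraph.root r' (fingraph.root r' a) == fingraph.root r' a.
  by rewrite (root_root r'C).
exists #|{: S}|, (fun a =>
  enum_rank (exist (fun b => fingraph.root r' b == b) _ (rootS a))).
exists (fun i => val (enum_val i)).
split=> [i|a b rab|T u ur a] /=.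
- rewrite -[RHS]enum_valK; congr enum_rank; apply/val_inj => /=.
  exact/eqP/(valP (enum_val i)).
- congr enum_rank; apply/val_inj/eqP => /=.
  by rewrite (root_connect r'C); apply: connect1; rewrite /r' rab.
rewrite enum_rankK /=; have /connectP[s sP ->] := connect_root r' a.
elim: s a sP => //= b s IHs a /andP[/orP[] /ur uab /IHs <-]; by rewrite uab.
Qed.

(** The direction of an affine subspace is a choice of a subspace of which it is
a translate; there is only one such subspace. *)
Lemma direction_translate (R : realType) (n : nat) (x : 'rV[R]_n)
    (U : {vspace 'rV[R]_n}) :
  direction [set x + u | u in [set` U]]%classic = U.
Proof.
rewrite /direction; case: xgetP => [V _ [y xU]|/(_ U)]; last by case; exists x.
have UV u : u \in U -> exists2 v, v \in V & x + u = y + v.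
  move=> uU; have: [set x + u | u in [set` U]]%classic (x + u) by exists u.
  by rewrite xU => -[v vV <-]; exists v.
have VU v : v \in V -> exists2 u, u \in U & x + u = y + v.
  move=> vV; have: [set y + u | u in [set` V]]%classic (y + v) by exists v.
  by rewrite -xU => -[u uU <-]; exists u.
have [v0 v0V] := UV 0 (mem0v _); rewrite addr0 => xE.
have [u0 u0U] := VU 0 (mem0v _); rewrite addr0 => yE.
apply/vspaceP => w; apply/idP/idP => [wV|wU].
  have [u uU] := VU w wV; rewrite -yE -addrA => /addrI uE.
  by rewrite -(addKr u0 w) -uE memvD ?memvN.
have [v vV] := UV w wU; rewrite xE -addrA => /addrI vE.
by rewrite -(addKr v0 w) vE memvD ?memvN.
Qed.

Section Differences.

Variables (R : realType) (n p : nat) (E : finType).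
Variables (lhs rhs : E -> 'I_n) (c : E -> nat).
Local Notation q := p.+2.

Definition difference_plane e : set 'rV[R]_n :=
  [set x | x ord0 (lhs e) - x ord0 (rhs e) = (c e)%:R]%classic.

Definition difference_model e : pred {ffun 'I_n -> 'I_q} :=
  fun y => y (lhs e) - y (rhs e) == (c e)%:R.

Lemma difference_plane_proper e : lhs e != rhs e -> difference_plane e <> setT.
Proof.
move=> ne hT.
have: difference_plane e (\row_a (if a == lhs e then - (c e).+1%:R else 0)).
  by rewrite hT.
rewrite /difference_plane /= !mxE eqxx eq_sym (negPf ne) subr0 => /eqP.
by rewrite eqr_oppLR -subr_eq0 opprK -natrD pnatr_eq0 addSn.
Qed.

(** The floors of the coordinates of a real solution solve the same equations
over the integers, because the right-hand sides are integers; so there is a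
solution modulo q.  Over both rings, the solutions are then the translates of
that particular one by the functions constant on the classes of the relation
lhs e ~ rhs e. *)
Lemma difference_card (B : {set E}) :
  (solutions difference_plane B !=set0)%classic ->
  #|model_solutions difference_model B| =
    (q ^ affine_dim (solutions difference_plane B))%N.
Proof.
case=> x0 x0B.
pose r a b := [exists e in B, (lhs e == a) && (rhs e == b)].
have rP e : e \in B -> r (lhs e) (rhs e).
  by move=> eB; apply/exists_inP; exists e; rewrite ?eqxx.
have [k [cls [rep [repK cls_r factor]]]] := relation_quotient r.
pose f (w : 'rV[R]_k) : 'rV[R]_n := \row_a w ord0 (cls a).
have f_lin : linear f by move=> a u v; apply/rowP => i; rewrite !mxE.
have [L LE] : exists L : 'Hom('rV[R]_k, 'rV[R]_n), L =1 f.
  pose fL := GRing.isLinear.Build _ _ _ _ f f_lin.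
  pose F : {linear 'rV[R]_k -> 'rV[R]_n} := HB.pack f fL.
  by exists (linfun F) => w; exact: lfunE.
have solE : solutions difference_plane B =
    [set x0 + u | u in [set` limg L]]%classic.
  apply/seteqP; split=> [x xB|_ [u /memv_imgP[w _ ->] <-] e eB] /=.
    exists (x - x0); last by rewrite addrC subrK.
    apply/memv_imgP; exists (\row_i (x - x0) ord0 (rep i)); first exact: memvf.
    rewrite LE; apply/rowP => a; rewrite [RHS]mxE [RHS]mxE.
    apply: (factor R (fun b => (x - x0) ord0 b)) => a1 b.
    case/exists_inP=> e eB /andP[/eqP <- /eqP <-]; rewrite !mxE.
    have xE : _ = _ := x0B e eB; rewrite -(xB e eB) in xE.
    apply/eqP; rewrite subr_eq -addrA [- _ + _]addrC xE.
    by rewrite addrC subrK.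
  rewrite /difference_plane /= !mxE LE !mxE (cls_r _ _ (rP e eB)).
  by rewrite opprD addrACA subrr addr0; apply: x0B.
have -> : affine_dim (solutions difference_plane B) = k.
  rewrite /affine_dim solE direction_translate limg_dim_eq.
    by rewrite dimvf /dim /= mul1n.
  apply/vspaceP => w; rewrite memv0 memv_cap memvf memv_ker LE /=.
  apply/eqP/eqP => [/rowP fw|->]; last by apply/rowP => i; rewrite !mxE.
  by apply/rowP => i; have := fw (rep i); rewrite !mxE repK.
pose y0 : {ffun 'I_n -> 'I_q} := [ffun a => (Num.floor (x0 ord0 a))%:~R].
have y0B e : e \in B -> difference_model e y0.
  move=> /x0B; rewrite /difference_plane /difference_model /= !ffunE => /eqP.
  rewrite subr_eq => /eqP->.
  rewrite -[(c e)%:R]/((c e)%:~R) floorDzr ?intr_int // intrKfloor.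
  by rewrite rmorphD /= addrK.
pose g (w : {ffun 'I_k -> 'I_q}) : {ffun 'I_n -> 'I_q} :=
  [ffun a => y0 a + w (cls a)].
have g_inj : injective g.
  move=> w1 w2 /ffunP gw; apply/ffunP => i.
  by have := gw (rep i); rewrite !ffunE repK => /addrI.
rewrite -[k in RHS]card_ord -[q in RHS]card_ord -card_ffun -cardsT.
rewrite -(card_imset _ g_inj); apply: eq_card => y.
apply/in_model_solutions/imsetP => [yB|[w _ ->] e eB]; last first.
  rewrite /difference_model !ffunE (cls_r _ _ (rP e eB)) opprD addrACA subrr.
  by have := y0B e eB; rewrite /difference_model !ffunE addr0.
exists [ffun i => y (rep i) - y0 (rep i)]; rewrite ?inE //.
apply/ffunP => a; rewrite ffunE [X in _ + X]ffunE; apply/eqP.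
rewrite addrC -subr_eq; apply/eqP.
apply: (factor _ (fun b => y b - y0 b)) => a1 b.
case/exists_inP=> e eB /andP[/eqP <- /eqP <-].
have /eqP yE := y0B e eB; move/eqP: (yB e eB); rewrite -yE => {}yE.
apply/eqP; rewrite subr_eq -addrA [- _ + _]addrC -yE.
by rewrite addrC subrK.
Qed.

(** The representatives in [0, q) of the differences y_o - y_a, negated, are a
real solution: 0 <= c < q makes c its own representative. *)
Lemma difference_lift (o : 'I_n) (y : {ffun 'I_n -> 'I_q}) :
    (forall e, c e < q)%N -> (forall e, c e = 0%N \/ lhs e = o) ->
  exists x, forall e, difference_model e y -> difference_plane e x.
Proof.
move=> c_lt c_o; pose d a : nat := val (y o - y a).
exists (\row_a - (d a)%:R) => e.
rewrite /difference_model /difference_plane /= !mxE => /eqP yE.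
case: (c_o e) yE => [->|->] yE.
  by move/eqP: yE; rewrite subr_eq0 /d => /eqP->; rewrite subrr.
have -> : d o = 0%N by rewrite /d subrr.
have -> : d (rhs e) = c e by rewrite /d yE Zp_nat /= modn_small.
by rewrite oppr0 add0r opprK.
Qed.

End Differences.

(** * The Ish arrangement modulo q *)

Definition avoiding_points (n p : nat) (n_gt0 : (0 < n)%N)
    (G : {set 'I_n * 'I_n}) : {set {ffun 'I_n -> 'I_p.+2}} :=
  [set y : {ffun 'I_n -> 'I_p.+2} | injectiveb y &
    [forall a in G, y (vertex1 n_gt0) - y a.2 != a.1.+1%:R]]%SET.

(** The equations are indexed by a disjoint sum, as the two families defining the
arrangement are independent of each other.  Injectivity of y is what avoiding
all the hyperplanes x_i = x_j amounts to. *)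
Lemma Ish_char_poly_count (R : realType) (n p : nat) (n_gt0 : (0 < n)%N)
    (G : {set 'I_n * 'I_n})
    (hG : forall i j : 'I_n, (i, j) \in G -> j != vertex1 n_gt0) :
    (n < p.+2)%N ->
  (char_poly_arr (Ish n_gt0 R G)).[p.+2%:R] = #|avoiding_points p n_gt0 G|%:R.
Proof.
move=> lt_n.
pose E : finType := ({a : 'I_n * 'I_n | (a.1 < a.2)%N} + {a | a \in G})%type.
pose lhs (e : E) := match e with inl a => (val a).1 | inr _ => vertex1 n_gt0 end.
pose rhs (e : E) := match e with inl a => (val a).2 | inr a => (val a).2 end.
pose c (e : E) := match e with inl _ => 0%N | inr a => (val a).1.+1 end.
rewrite (@char_poly_arr_model R n E {ffun 'I_n -> 'I_p.+2} p.+2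
  (difference_plane lhs rhs c) (difference_model lhs rhs c)).
- congr _%:R; apply: eq_card => y; rewrite !inE.
  apply/forallP/andP => [avoid|[/injectiveP y_inj /forall_inP yG]]; last first.
    case=> -[a Pa]; rewrite /difference_model /=; last exact: yG.
    rewrite subr_eq0; apply: contraTneq Pa => /y_inj ->.
    by rewrite ltnn.
  split; last first.
    by apply/forall_inP => a aG; apply: (avoid (inr (exist _ a aG))).
  suff lt_neq (a b : 'I_n) : (a < b)%N -> y a != y b.
    apply/injectiveP => a b yab; case: (ltngtP a b) => [ab|ba|/val_inj//].
      by case/negP: (lt_neq _ _ ab); apply/eqP.
    by case/negP: (lt_neq _ _ ba); apply/eqP.
  move=> ab; rewrite -subr_eq0.
  by have := avoid (inl (exist (fun a : 'I_n * 'I_n => a.1 < a.2)%N (a, b) ab)).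
- move=> H; rewrite inE; split.
    case/orP=> /imfsetP[a /= Pa ->]; first by exists (inl (exist _ a Pa)).
    by exists (inr (exist _ a Pa)).
  case=> -[[a Pa]|[a Pa]] ->; apply/orP; [left|right]; last first.
    by apply/imfsetP; exists a.
  by apply/imfsetP; exists a.
- case=> -[a Pa]; apply: difference_plane_proper => /=.
    by apply: contraTneq Pa => ->; rewrite ltnn.
  by case: a Pa => i j /hG; rewrite eq_sym.
- move=> y; apply: (@difference_lift R n p E lhs rhs c (vertex1 n_gt0)).
    by case=> -[a Pa] //=; apply: leq_ltn_trans lt_n.
  by case=> a; [left|right].
- exact: difference_card.
Qed.

(** * Path-cycle covers as arc sets of in- and outdegree at most one *)

Section ZipPath.

Variable T : eqType.
Implicit Types (s t : seq T) (x y : T).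

Lemma mem_zip s t a : a \in zip s t -> a.1 \in s /\ a.2 \in t.
Proof.
elim: s t => [|x s IHs] [|y t] //=; rewrite !inE.
by case/orP=> [/eqP->|/IHs[-> ->]]; rewrite ?eqxx ?orbT.
Qed.

Lemma zip_fst_inj s t : uniq s -> {in zip s t &, injective fst}.
Proof.
elim: s t => [|x s IHs] [|y t] //= /andP[xs us] a b; rewrite !inE.
case/orP=> [/eqP->|az] /orP[/eqP->|bz] //= abE; last exact: (IHs t).
  by case/negP: xs; rewrite abE; case: (mem_zip bz).
by case/negP: xs; rewrite -abE; case: (mem_zip az).
Qed.

Lemma zip_snd_inj s t : uniq t -> {in zip s t &, injective snd}.
Proof.
elim: s t => [|x s IHs] [|y t] //= /andP[yt ut] a b; rewrite !inE.
case/orP=> [/eqP->|az] /orP[/eqP->|bz] //= abE; last exact: (IHs t).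
  by case/negP: yt; rewrite abE; case: (mem_zip bz).
by case/negP: yt; rewrite -abE; case: (mem_zip az).
Qed.

Lemma zip_rcons_last y t x :
  zip (y :: t) (rcons t x) = rcons (zip (y :: t) t) (last y t, x).
Proof. by elim: t y => //= z t IHt y; rewrite -IHt. Qed.

Lemma path_zip (r : rel T) y t :
  path r y t = all (fun a => r a.1 a.2) (zip (y :: t) t).
Proof. by elim: t y => //= z t IHt y; rewrite -IHt. Qed.

(** The members of zip (y :: t) t are the pairs of consecutive elements of the
list y :: t, that is, the arcs of that path. *)
Lemma mem_zip_succ y t x :
  x \in y :: t -> x = last y t \/ exists z, (x, z) \in zip (y :: t) t.
Proof.
elim: t y => /= [|z t IHt] y; rewrite inE; first by move/eqP; left.
case/predU1P=> [->|/IHt[->|[w xw]]]; [right|by left|right].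
  by exists z; rewrite mem_head.
by exists w; rewrite inE xw orbT.
Qed.

Lemma mem_zip_pred y t x : x \in t -> exists z, (z, x) \in zip (y :: t) t.
Proof.
elim: t y => //= z t IHt y; rewrite inE.
case/predU1P=> [->|/(IHt z)[w wx]]; first by exists y; rewrite mem_head.
by exists w; rewrite inE wx orbT.
Qed.

End ZipPath.

Section Covers.

Variable V : finType.
Implicit Types (S D : {set V * V}) (C : {set V}) (s : seq V).

Lemma cycle_arcs_cons y s :
  cycle_arcs (y :: s) = (last y s, y) |: path_arcs (y :: s).
Proof.
apply/setP => a.
by rewrite /cycle_arcs rot1_cons zip_rcons_last !inE mem_rcons inE.
Qed.

Lemma card_path_arcs s : uniq s -> #|path_arcs s| = (size s).-1.
Proof.
move=> us; rewrite cardsE (card_uniqP _) ?zip_uniql //.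
by rewrite size_zip size_behead; apply/minn_idPr/leq_pred.
Qed.

Lemma card_cycle_arcs s : uniq s -> #|cycle_arcs s| = size s.
Proof.
move=> us; rewrite cardsE (card_uniqP _) ?zip_uniql //.
by rewrite size_zip size_rot minnn.
Qed.

Lemma weak_connect_sym S : connect_sym (adjacent S).
Proof. by apply: sym_connect_sym => u v; rewrite /adjacent orbC. Qed.

Lemma weak_components_partition S :
  finset.partition (weak_components S) [set: V].
Proof.
apply: equivalence_partitionP => x y z _ _ _; split; first exact: connect0.
by move=> xy; apply: (same_connect (@weak_connect_sym S) xy).
Qed.

Lemma weak_componentsP S C :
  reflect (exists x, C = [set y | connect (adjacent S) x y])
          (C \in weak_components S).
Proof.
apply: (iffP imsetP) => [[x _ ->]|[x ->]]; exists x => //; apply/setP => y;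
  by rewrite !inE.
Qed.

Lemma mem_weak_component S C a : C \in weak_components S -> a \in S ->
  (a.1 \in C) = (a.2 \in C).
Proof.
case/weak_componentsP=> x -> aS; rewrite !inE.
apply: (same_connect_r (@weak_connect_sym S)); apply: connect1.
by rewrite /adjacent -surjective_pairing aS.
Qed.

(** A path through x extended greedily at both ends, until every arc leaving its
last vertex or entering its first one comes back to the path. *)
Lemma maximal_path (r : rel V) x :
  exists y s, [/\ uniq (y :: s), path r y s, x \in y :: s,
    forall z, r (last y s) z -> z \in y :: s
    & forall z, r z y -> z \in y :: s].
Proof.
(* k bounds the number of vertices that can still be added. *)
suff H k y s : uniq (y :: s) -> path r y s -> x \in y :: s ->
    (#|V| <= size (y :: s) + k)%N -> exists y s, [/\ uniq (y :: s), path r y s,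
      x \in y :: s, forall z, r (last y s) z -> z \in y :: s
      & forall z, r z y -> z \in y :: s].
  by apply: (H #|V| x [::]); rewrite ?mem_head ?leq_addl.
elim: k y s => [|k IHk] y s us ys xs; rewrite ?addn0 ?addnS => leVs.
  have sV z : z \in y :: s.
    have: [set u in y :: s]%SET = [set: V]%SET.
      apply/eqP; rewrite eqEcard finset.subsetT cardsT cardsE.
      by rewrite (card_uniqP us).
    by move/setP/(_ z); rewrite !inE.
  by exists y, s; split.
have [/existsP[z /andP[zs rz]]|/existsPn noR] :=
  boolP [exists z, (z \notin y :: s) && r (last y s) z].
  apply: (IHk y (rcons s z)).
  - by rewrite -rcons_cons rcons_uniq zs.
  - by rewrite rcons_path ys.
  - by rewrite -rcons_cons mem_rcons inE xs orbT.
  - by rewrite /= size_rcons addSn.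
have [/existsP[z /andP[zs rz]]|/existsPn noL] :=
  boolP [exists z, (z \notin y :: s) && r z y].
  apply: (IHk z (y :: s)) => //.
  - by rewrite [uniq _]/= -/(uniq (y :: s)) zs.
  - by rewrite /= rz.
  - by rewrite inE xs orbT.
exists y, s; split=> // z rz.
  by have := noR z; rewrite rz andbT negbK.
by have := noL z; rewrite rz andbT negbK.
Qed.

(** With degrees at most one, an inner vertex of a maximal path s has its two
arcs on s, and by maximality no arc leaves s at its ends.  So s fills its
component, and the only arc that can occur besides those of s goes from its
last vertex to its first. *)
Lemma component_path_or_cycle S C :
    {in S &, injective fst} -> {in S &, injective snd} ->
  C \in weak_components S -> dipath_on S C || dicycle_on S C.
Proof.
move=> S1 S2 CS; have /weak_componentsP[x CE] := CS.
have [y [s [us ys xs maxR maxL]]] := maximal_path (fun u v => (u, v) \in S) x.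
have arcS a : a \in zip (y :: s) s -> a \in S.
  by move: ys; rewrite path_zip => /allP/[apply]; rewrite -surjective_pairing.
have sndS a : a \in S -> a.2 \in s -> a \in zip (y :: s) s.
  move=> aS /(mem_zip_pred y)[z zs].
  by rewrite (S2 _ _ aS (arcS _ zs)).
have fwd a : a \in S -> a.1 \in y :: s ->
    a.1 = last y s \/ a \in zip (y :: s) s.
  move=> aS /mem_zip_succ[|[z zs]]; first by left.
  by right; rewrite (S1 _ _ aS (arcS _ zs)).
have mem_arc a : a \in zip (y :: s) s -> (a.1 \in y :: s) && (a.2 \in y :: s).
  by case/mem_zip=> -> a2; rewrite inE a2 orbT.
have closed_s : closed (adjacent S) (mem (y :: s)).
  apply: (intro_closed (@weak_connect_sym S)) => u v /orP[uvS|vuS] us'.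
    case: (fwd _ uvS us') => [/= uE|/mem_arc/andP[] //].
    by apply: maxR; rewrite -uE.
  move: us'; rewrite inE => /predU1P[uE|us']; first by apply: maxL; rewrite -uE.
  by have /mem_arc/andP[] := sndS _ vuS us'.
have CsE : [set v in y :: s] = C.
  rewrite CE; apply/setP => v; rewrite !inE -in_cons.
  apply/idP/idP => vs; last by rewrite -(closed_connect closed_s vs).
  have yC w : w \in y :: s -> connect (adjacent S) y w.
    apply: path_connect; apply: sub_path ys => u w' uw'.
    by rewrite /adjacent uw'.
  by apply: connect_trans (yC v vs); rewrite weak_connect_sym yC.
have szs : size (y :: s) == #|C| by rewrite -CsE cardsE (card_uniqP us).
have sub_arcs : path_arcs (y :: s) \subset arcs_within S C.
  apply/fintype.subsetP => a; rewrite inE => az.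
  by rewrite inE arcS // -CsE !inE -!in_cons mem_arc.
have arcs_sub : arcs_within S C \subset cycle_arcs (y :: s).
  apply/fintype.subsetP => a; rewrite cycle_arcs_cons !inE -CsE !inE -!in_cons /=.
  case/and3P=> aS a1 a2; rewrite in_cons.
  have [aE|->] := fwd a aS a1; last by rewrite orbT.
  move: a2; rewrite inE => /orP[/eqP a2E|/(sndS a aS)->]; last by rewrite orbT.
  by rewrite [a]surjective_pairing aE a2E eqxx.
have [laS|laS] := boolP ((last y s, y) \in S).
  apply/orP; right; apply/existsP; exists (Tuple szs); rewrite us CsE eqxx /=.
  rewrite finset.eqEsubset arcs_sub cycle_arcs_cons finset.subUset sub_arcs andbT.
  by rewrite finset.sub1set inE laS -CsE !inE -!in_cons mem_last mem_head.
apply/orP; left; apply/existsP; exists (Tuple szs); rewrite us CsE eqxx /=.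
rewrite finset.eqEsubset sub_arcs andbT; apply/fintype.subsetP => a aA.
have := fintype.subsetP arcs_sub a aA; rewrite cycle_arcs_cons => /setU1P[aE|//].
by move: aA laS; rewrite inE aE => /andP[->].
Qed.

Lemma dipath_onP S C : dipath_on S C -> exists s,
  [/\ uniq s, size s = #|C| & arcs_within S C = path_arcs s].
Proof.
case/existsP=> s /and3P[us _ /eqP SC].
by exists s; rewrite size_tuple.
Qed.

Lemma dicycle_onP S C : dicycle_on S C -> exists s,
  [/\ uniq s, size s = #|C| & arcs_within S C = cycle_arcs s].
Proof.
case/existsP=> s /and3P[us _ /eqP SC].
by exists s; rewrite size_tuple.
Qed.

(** Conversely to component_path_or_cycle, two arcs with a common tail, or a
common head, lie in the same component, and neither a path nor a cycle has such
a pair. *)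
Lemma path_cycle_coverP D S :
  reflect [/\ S \subset D, {in S &, injective fst} & {in S &, injective snd}]
          (path_cycle_cover D S).
Proof.
apply: (iffP andP) => [[SD /forall_inP pieces]|[SD S1 S2]]; last first.
  by split=> //; apply/forall_inP => C; apply: component_path_or_cycle.
have /and3P[/eqP coverV _ _] := weak_components_partition S.
have comp x : exists2 C, C \in weak_components S & x \in C.
  have xP : x \in finset.cover (weak_components S) by rewrite coverV inE.
  exists (finset.pblock (weak_components S) x).
    exact: finset.pblock_mem.
  by rewrite finset.mem_pblock.
have within C : C \in weak_components S ->
    {in arcs_within S C &, injective fst} /\
    {in arcs_within S C &, injective snd}.
  move=> /pieces/orP[/dipath_onP|/dicycle_onP] [s [us _ ->]].
    split=> a b; rewrite !inE; first exact: zip_fst_inj.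
    by apply: zip_snd_inj; case: (s) us => //= ? ? /andP[].
  split=> a b; rewrite !inE; first exact: zip_fst_inj.
  by apply: zip_snd_inj; rewrite rot_uniq.
split=> // a b aS bS abE.
  have [C CS aC] := comp a.1; have [inj1 _] := within C CS.
  by apply: inj1 => //; rewrite inE ?aS ?bS -(mem_weak_component CS) // -?abE aC.
have [C CS aC] := comp a.2; have [_ inj2] := within C CS.
by apply: inj2 => //; rewrite inE ?aS ?bS (mem_weak_component CS) // -?abE aC.
Qed.

(** A path on l vertices has l - 1 arcs and a cycle has l: the vertices exceed the
arcs by one in each path. *)
Lemma num_paths_cover D S : path_cycle_cover D S ->
  (num_paths S + #|S| = #|V|)%N.
Proof.
case/andP=> _ /forall_inP pieces.
have P := weak_components_partition S; have /and3P[/eqP coverV triv P0] := P.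
have pblockE C x : C \in weak_components S ->
    (finset.pblock (weak_components S) x == C) = (x \in C).
  move=> CS; apply/eqP/idP => [<-|]; last exact: finset.def_pblock.
  by rewrite finset.mem_pblock coverV inE.
rewrite -cardsT (card_partition P).
have -> : #|S| = (\sum_(C in weak_components S) #|arcs_within S C|)%N.
  rewrite -sum1_card (partition_big (fun a => finset.pblock (weak_components S) a.1)
    (mem (weak_components S))) /=; last first.
    by move=> a aS; apply: finset.pblock_mem; rewrite coverV inE.
  apply: eq_bigr => C CS; rewrite -sum1_card; apply: eq_bigl => a.
  rewrite inE pblockE //; case: (boolP (a \in S)) => //= aS.
  by rewrite (mem_weak_component CS aS) andbb.
rewrite /num_paths -sum1_card.
under eq_bigl do rewrite inE.
rewrite big_mkcondr -big_split; apply: eq_bigr => C CS /=.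
have C_gt0 : (0 < #|C|)%N.
  by rewrite card_gt0; apply: contraNneq P0 => <-.
have := pieces C CS; case: ifP => [+ _|_ /= cyc].
  by case/dipath_onP=> s [us sz ->]; rewrite card_path_arcs // sz add1n prednK.
by case/dicycle_onP: cyc => s [us sz ->]; rewrite card_cycle_arcs.
Qed.

End Covers.

(** * Counting the points off the arrangement by path-cycle covers *)

Section Counting.

Variables (n p : nat) (n_gt0 : (0 < n)%N).
Hypothesis lt_n : (n < p.+2)%N.
Local Notation q := p.+2.
Local Notation v1 := (vertex1 n_gt0).
Implicit Types (S D G : {set 'I_n * 'I_n}) (z : {ffun 'I_n -> 'I_q}).

(** The vertex 1 <= i <= n is the ordinal i - 1, hence the successor: these are
the arcs from z_j to j, for the z_j among 1, ..., n. *)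
Definition small_arcs z : {set 'I_n * 'I_n} :=
  [set a : 'I_n * 'I_n | z a.2 == a.1.+1 :> nat]%SET.

(** The normal form z_j = y_1 - y_j of a point y. *)
Definition rooted_injections D : {set {ffun 'I_n -> 'I_q}} :=
  [set z : {ffun 'I_n -> 'I_q} |
    [&& injectiveb z, z v1 == 0 & small_arcs z \subset D]]%SET.

Lemma val_vertex (i : 'I_n) : nat_of_ord (i.+1%:R : 'I_q) = i.+1.
Proof. by rewrite Zp_nat /= modn_small // (leq_ltn_trans _ lt_n). Qed.

(** y is recovered from z as y_j = t - z_j, where t = y_1 is arbitrary. *)
Lemma card_avoiding_points_rooted G :
  #|avoiding_points p n_gt0 G| =
    (q * #|rooted_injections (Ish_complement n_gt0 G)|)%N.
Proof.
pose f (u : 'I_q * {ffun 'I_n -> 'I_q}) : {ffun 'I_n -> 'I_q} :=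
  [ffun a => u.1 - u.2 a].
have rooted0 (z : {ffun 'I_n -> 'I_q}) :
    z \in rooted_injections (Ish_complement n_gt0 G) -> z v1 = 0.
  by rewrite inE => /and3P[_ /eqP].
set N := rooted_injections _ in rooted0 *.
have <- : #|finset.setX [set: 'I_q]%SET N| = (q * #|N|)%N.
  by rewrite cardsX cardsT card_ord.
rewrite -(card_in_imset (f := f)).
  apply: eq_card => y; rewrite inE; apply/andP/imsetP.
    case=> /injectiveP y_inj /forall_inP yG.
    exists (y v1, [ffun a => y v1 - y a] : {ffun _ -> _}); last first.
      by apply/ffunP => a; rewrite !ffunE /= opprB addrC subrK.
    rewrite !inE /= ffunE subrr eqxx; apply/andP; split.
      by apply/injectiveP => a b; rewrite !ffunE => /addrI/oppr_inj/y_inj.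
    apply/fintype.subsetP => a; rewrite !inE ffunE => /eqP ya.
    apply/andP; split.
      apply/negP => /yG/eqP; apply; apply/val_inj.
      by rewrite [RHS]val_vertex.
    by apply/eqP => a2; move: ya; rewrite a2 subrr.
  case=> -[t z] /finset.setXP[_ zN] ->; have z0 := rooted0 z zN.
  move: zN; rewrite inE => /and3P[/injectiveP z_inj _ /fintype.subsetP zD].
  split.
    by apply/injectiveP => a b; rewrite !ffunE => /addrI/oppr_inj/z_inj.
  apply/forall_inP => a aG; rewrite !ffunE /= z0 subr0 opprB addrC subrK.
  apply/eqP => za; have /zD : a \in small_arcs z by rewrite inE za val_vertex.
  by rewrite !inE aG.
move=> [t z] [t' z'] /finset.setXP[_ /rooted0 z0].
move=> /finset.setXP[_ /rooted0 z0'] /= /ffunP ff.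
have tt' : t = t' by have := ff v1; rewrite !ffunE /= z0 z0' !subr0.
congr (_, _) => //; apply/ffunP => a.
by have := ff a; rewrite !ffunE /= tt' => /addrI/oppr_inj.
Qed.

Lemma small_arcs_cover D z :
  z \in rooted_injections D -> path_cycle_cover D (small_arcs z).
Proof.
rewrite inE => /and3P[/injectiveP z_inj _ zD].
apply/path_cycle_coverP; split=> // a b; rewrite !inE => /eqP za /eqP zb ab.
  rewrite [a]surjective_pairing [b]surjective_pairing ab; congr (_, _).
  by apply/z_inj/val_inj; rewrite /= za zb ab.
rewrite [a]surjective_pairing [b]surjective_pairing ab; congr (_, _).
by apply/val_inj; apply/eqP; rewrite -eqSS -za -zb ab.
Qed.

Lemma card_root_heads D S : (forall a, a \in D -> a.2 != v1) ->
  path_cycle_cover D S -> #|v1 |: [set a.2 | a in S]%SET| = #|S|.+1.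
Proof.
move=> Dv1 /path_cycle_coverP[SD _ S2]; rewrite cardsU1 card_in_imset //.
suff -> : v1 \notin [set a.2 | a in S]%SET by [].
by apply/imsetP => -[a /(fintype.subsetP SD)/Dv1 + v1E]; rewrite -v1E eqxx.
Qed.

(** The arcs of S prescribe the values of z at their heads, and the value at
vertex 1 is 0.  At each of the remaining vertices z may take any value above n,
provided these values are distinct. *)
Lemma card_small_arcs_fibre D S :
    (forall a, a \in D -> a.2 != v1) -> path_cycle_cover D S ->
  #|[set z in rooted_injections D | small_arcs z == S]%SET| =
    ((q - n.+1) ^_ (num_paths S).-1)%N.
Proof.
move=> Dv1 SDcover; have /path_cycle_coverP[SD S1 S2] := SDcover.
pose free := ~: (v1 |: [set a.2 | a in S])%SET.
have card_free : #|{: {j | j \in free}}| = (num_paths S).-1.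
  rewrite card_sig cardsCs finset.setCK (card_root_heads Dv1 SDcover).
  by rewrite -(num_paths_cover SDcover) subnS addnK.
have freeP j : [\/ j = v1, exists i, (i, j) \in S | j \in free].
  rewrite !inE; have [|_] := eqVneq; first by constructor 1.
  have [/imsetP[[i k] iS ->]|_] := boolP (_ \in imset _ _); last by constructor 3.
  by constructor 2; exists i.
pose big := [pred w : 'I_q | (n < w)%N].
have card_big : #|big| = (q - n.+1)%N.
  rewrite -sum1_card -(big_mkord (fun w => n < w)%N (fun=> 1%N)).
  by rewrite -(big_nat_widenl n.+1 0 q predT) // sum_nat_const_nat muln1.
rewrite -card_big -card_free -card_inj_ffuns_on.
pose f z : {ffun {j | j \in free} -> 'I_q} := [ffun t => z (val t)].
rewrite -(card_in_imset (f := f)); last first.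
  move=> z z'; rewrite !inE => /andP[/and3P[_ /eqP z0 _] /eqP zS].
  case/andP=> /and3P[_ /eqP z0' _] /eqP zS' /ffunP ff.
  apply/ffunP => j; case: (freeP j) => [->|[i ijS]|jT]; first by rewrite z0 z0'.
    apply/val_inj; move: (ijS); rewrite -{1}zS inE => /eqP /= ->.
    by move: ijS; rewrite -zS' inE => /eqP.
  by have := ff (exist _ j jT); rewrite !ffunE.
apply: eq_card => g; rewrite inE; apply/imsetP/andP.
  case=> z; rewrite !inE => /andP[/and3P[/injectiveP z_inj /eqP z0 _] /eqP zS] ->.
  split; last first.
    by apply/injectiveP => t t'; rewrite !ffunE => /z_inj/val_inj.
  apply/ffun_onP => -[j jT]; rewrite ffunE !inE /= ltnNge; apply/negP => zj.
  move: jT; rewrite !inE negb_or => /andP[jv1 /negP]; apply.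
  case zjE: (val (z j)) zj => [|i] zj.
    by case/eqP: jv1; apply/z_inj/val_inj; rewrite z0.
  apply/imsetP; exists (Ordinal zj, j) => //.
  by rewrite -zS inE /= -zjE.
case=> /ffun_onP g_big /injectiveP g_inj.
pose z : {ffun 'I_n -> 'I_q} := [ffun j => if insub j is Some t then g t else
  if [pick i | (i, j) \in S] is Some i then (val i).+1%:R else 0].
have zT (t : {j | j \in free}) : z (val t) = g t by rewrite ffunE valK.
have notT j : j \notin free -> insub j = None :> option {j | j \in free}.
  by move=> jT; rewrite insubN.
have z0 : z v1 = 0.
  rewrite ffunE notT ?inE ?eqxx //; case: pickP => // i iS.
  by have := Dv1 _ (fintype.subsetP SD _ iS); rewrite eqxx.
have zS i j : (i, j) \in S -> val (z j) = i.+1.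
  move=> ijS; rewrite ffunE notT; last first.
    by rewrite !inE negbK; apply/orP; right; apply/imsetP; exists (i, j).
  case: pickP => [k kjS|/(_ i)]; last by rewrite ijS.
  by have [->] := S2 _ _ kjS ijS erefl; apply: val_vertex.
have zS_E : small_arcs z = S.
  apply/setP => -[i j]; rewrite inE /=; apply/eqP/idP => [zj|/zS//].
  case: (freeP j) => [jE|[k kjS]|jT].
  - by move: zj; rewrite jE z0.
  - by move: zj (kjS); rewrite (zS _ _ kjS) => -[/val_inj->].
  - move: zj; rewrite (zT (exist _ j jT)) => zj.
    by have := g_big (exist _ j jT); rewrite inE zj ltnNge ltn_ord.
have z_free j : j \in free -> (n < z j)%N.
  by move=> jT; rewrite (zT (exist _ j jT)); apply: g_big.
have z_inj : injective z.
  move=> j j' /(congr1 val) /= zz.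
  have [jE|[i ijS]|jT] := freeP j; have [jE'|[i' ijS']|jT'] := freeP j'.
  - by rewrite jE jE'.
  - by move: zz; rewrite jE z0 [RHS](zS _ _ ijS').
  - by have := z_free _ jT'; rewrite -zz jE z0.
  - by move: zz; rewrite jE' z0 [LHS](zS _ _ ijS).
  - move: zz (ijS); rewrite [LHS](zS _ _ ijS) [RHS](zS _ _ ijS') => -[/val_inj->].
    by move=> i'jS; case: (S1 _ _ i'jS ijS' erefl).
  - by have := z_free _ jT'; rewrite -zz [X in (_ < X)%N](zS _ _ ijS) ltnNge ltn_ord.
  - by have := z_free _ jT; rewrite zz jE' z0.
  - by have := z_free _ jT; rewrite zz [X in (_ < X)%N](zS _ _ ijS') ltnNge ltn_ord.
  - move/val_inj: zz; rewrite (zT (exist _ j jT)) (zT (exist _ j' jT')).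
    by move/g_inj => -[].
exists z; last by apply/ffunP => t; rewrite ffunE zT.
by rewrite !inE zS_E SD z0 !eqxx andbT; apply/andP; split=> //; apply/injectiveP.
Qed.

Lemma card_avoiding_points G :
  #|avoiding_points p n_gt0 G| =
    (q * \sum_(1 <= k < n.+1)
       pc k (Ish_complement n_gt0 G) * (q - n.+1) ^_ k.-1)%N.
Proof.
rewrite card_avoiding_points_rooted; congr (_ * _)%N.
set D := Ish_complement n_gt0 G.
have Dv1 a : a \in D -> a.2 != v1 by rewrite !inE => /andP[].
rewrite -sum1_card (partition_big small_arcs (path_cycle_cover D)) /=; last first.
  by move=> z; apply: small_arcs_cover.
transitivity (\sum_(S | path_cycle_cover D S) (q - n.+1) ^_ (num_paths S).-1)%N.
  apply: eq_bigr => S /(card_small_arcs_fibre Dv1) <-.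
  by rewrite -sum1_card; apply: eq_bigl => z; rewrite [RHS]inE.
have paths_gt0 S : path_cycle_cover D S -> (0 < num_paths S <= n)%N.
  move=> SDcover; have := num_paths_cover SDcover; rewrite card_ord => nE.
  apply/andP; split; last by rewrite -[X in (_ <= X)%N]nE leq_addr.
  rewrite -(ltn_add2r #|S|) nE -(card_root_heads Dv1 SDcover).
  by rewrite -[X in (_ <= X)%N]card_ord max_card.
transitivity (\sum_(1 <= k < n.+1)
    \sum_(S | path_cycle_cover D S && (num_paths S == k)) (q - n.+1) ^_ k.-1)%N.
  rewrite (exchange_big_dep (path_cycle_cover D)) /=; last by move=> k S _ /andP[].
  apply: eq_bigr => S SDcover; under eq_bigl do rewrite SDcover eq_sym.
  by rewrite big_nat1_eq paths_gt0.
by apply: eq_bigr => k _; rewrite sum_nat_cond_const.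
Qed.

End Counting.

(** * Comparing the two polynomials at large integers *)

Lemma poly_eq_large_nat (P Q : {poly int}) (N : nat) :
  (forall m, (N <= m)%N -> P.[m%:R] = Q.[m%:R]) -> P = Q.
Proof.
move=> PQ; apply/eqP; rewrite -subr_eq0; apply: contraT => PQ0.
pose rs : seq int := [seq m%:R | m <- iota N (size (P - Q))].
have := max_poly_roots PQ0 (rs := rs); rewrite size_map size_iota ltnn.
apply.
  apply/allP => _ /mapP[m + ->]; rewrite mem_iota => /andP[Nm _].
  by rewrite /root hornerD hornerN PQ // subrr.
by rewrite map_inj_uniq ?iota_uniq // => i j /eqP; rewrite eqr_nat => /eqP.
Qed.

Lemma falling_natr (K : pzRingType) (m r : nat) :
  falling (m%:R : K) r = (m ^_ r)%:R.
Proof.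
elim: r => [|r IHr]; first by rewrite /falling big_ord0.
rewrite /falling big_ord_recr /= -/(falling _ r) IHr ffactnSr natrM.
(* The truncated difference of m and r is not m - r when r > m, but both sides
   then contain the factor m - m. *)
have [le_rm|lt_mr] := leqP r m; first by rewrite natrB.
by rewrite ffact_small // !mul0r.
Qed.

Lemma horner_falling (K : comNzRingType) (P : {poly K}) (x : K) (r : nat) :
  (falling P r).[x] = falling P.[x] r.
Proof.
rewrite /falling horner_prod; apply: eq_bigr => i _.
by rewrite -polyC_natr !hornerE.
Qed.

Theorem theorem4p1 (R : realType) (n : nat) (n_gt0 : (0 < n)%N)
    (G : {set 'I_n * 'I_n})
    (hG : forall i j : 'I_n, (i, j) \in G -> j != vertex1 n_gt0) :
  char_poly_arr (Ish n_gt0 R G) =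
    'X * \sum_(1 <= k < n.+1)
           (pc k (Ish_complement n_gt0 G))%:R * falling ('X - n%:R - 1) k.-1
  :> {poly int}.
Proof.
apply: (@poly_eq_large_nat _ _ n.+2) => -[|[|p]] // lt_np.
have lt_n : (n < p.+2)%N by apply: leq_trans lt_np; rewrite ltnS.
rewrite Ish_char_poly_count // (card_avoiding_points _ lt_n).
rewrite hornerM hornerX horner_sum natrM natr_sum; congr (_ * _).
apply: eq_bigr => k _; rewrite natrM hornerM horner_falling.
rewrite -falling_natr natrB // -polyC_natr hornerC; congr (_ * falling _ _).
by rewrite -[n.+1%:R]natr1 -polyC_natr !hornerE opprD addrA.
Qed.
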